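(* Let $(A,u^1,u^2)$ be a two-player (non-zero-sum) Borel game, where $A$ is a nonempty set of actions and $u^1,u^2 : A^{\mathbf N}\to\mathbf R$ are the payoff functions. If $u^1$ and $u^2$ are lower-semi-continuous and bounded, then for every $\varepsilon>0$ the game admits a subgame-perfect $\varepsilon$-equilibrium.
   Context: $\mathbf N=\{1,2,\ldots\}$. A play is an element $p=(a_t)_{t\in\mathbf N}$ of $A^{\mathbf N}$. The game: at every odd stage $t$ player 1 chooses $a_t\in A$, and at every even stage $t$ player 2 chooses $a_t\in A$, knowing $(a_j)_{j<t}$. The payoff to player $i\in\{1,2\}$ is $u^i(a_1,a_2,\ldots)$. Finite histories are finite sequences of elements of $A$, including the empty one $\emptyset$. $H^1$ is the set of finite histories of even length (including $\emptyset$; player 1 moves) and $H^2$ is the set of finite histories of odd length (player 2 moves). A (pure) strategy of player $i$ is a function $\sigma^i:H^i\to A$; $\Sigma^i$ is the set of strategies of player $i$. For a finite history $h=(a_1,\ldots,a_l)$ and strategies $(\sigma^1,\sigma^2)\in\Sigma^1\times\Sigma^2$, the play $p(\sigma^1,\sigma^2\mid h)=(b_t)_{t\in\mathbf N}$ is defined by $b_j=a_j$ for $1\le j\le l$, and for $t>l$: $b_t=\sigma^1(b_1,\ldots,b_{t-1})$ if $t$ is odd, $b_t=\sigma^2(b_1,\ldots,b_{t-1})$ if $t$ is even. Put $u^i(\sigma^1,\sigma^2\mid h)=u^i(p(\sigma^1,\sigma^2\mid h))$. For $\varepsilon\ge 0$, a pair $(\sigma^1_*,\sigma^2_* )\in\Sigma^1\times\Sigma^2$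 is a subgame-perfect $\varepsilon$-equilibrium if for every finite history $h\in H^1\cup H^2$: $u^1(\sigma^1_*,\sigma^2_*\mid h)\ge u^1(\sigma^1,\sigma^2_*\mid h)-\varepsilon$ for all $\sigma^1\in\Sigma^1$, and $u^2(\sigma^1_*,\sigma^2_*\mid h)\ge u^2(\sigma^1_*,\sigma^2\mid h)-\varepsilon$ for all $\sigma^2\in\Sigma^2$. $A$ carries the discrete topology and $A^{\mathbf N}$ the product topology. The function $u^i$ is lower-semi-continuous if for every sequence $(p^k)_{k\in\mathbf N}$ of plays in $A^{\mathbf N}$ converging to a play $p$ one has $\liminf_{k\to\infty}u^i(p^k)\ge u^i(p)$. *)

(* Defs.v *)
From HB Require Import structures.
From mathcomp Require Import all_boot all_order all_algebra.
From mathcomp Require Import all_classical all_reals all_analysis.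
Set Implicit Arguments.
Unset Strict Implicit.
Unset Printing Implicit Defensive.
Import Order.TTheory GRing.Theory Num.Theory.
Import numFieldNormedType.Exports.
Local Open Scope classical_set_scope.
Local Open Scope ring_scope.

(* Stages are numbered from 0: [p t] is the action a_(t+1) of the play p, so
   player 1 moves at the even indices and player 2 at the odd ones, i.e. after
   histories of even and odd length respectively.  Plays carry the product of
   the discrete topologies on A. *)
Definition play (A : pointedType) : Type :=
  prod_topology (fun _ : nat => discrete_topology A).

HB.instance Definition _ (A : pointedType) := Topological.on (play A).
HB.instance Definition _ (A : pointedType) := Pointed.on (play A).

Definition strategy1 (A : Type) := {h : seq A | ~~ odd (size h)} -> A.
Definition strategy2 (A : Type) := {h : seq A | odd (size h)} -> A.

Definition next_action (A : Type) (s1 : strategy1 A) (s2 : strategy2 A)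
    (h : seq A) : A :=
  match boolP (odd (size h)) with
  | AltTrue hodd => s2 (exist _ h hodd)
  | AltFalse heven => s1 (exist _ h heven)
  end.

(* [nth] returns its default exactly when size h <= t; the default is then the
   action chosen after the history of length t reached from h. *)
Definition play_from (A : pointedType) (s1 : strategy1 A) (s2 : strategy2 A)
    (h : seq A) : play A := fun t =>
  nth (next_action s1 s2
         (iter (t - size h) (fun h' => rcons h' (next_action s1 s2 h')) h)) h t.

Lemma play_from_history (A : pointedType) (s1 : strategy1 A) (s2 : strategy2 A)
    (h : seq A) (a : A) (t : nat) : (t < size h)%N ->
  play_from s1 s2 h t = nth a h t.
Proof. exact: set_nth_default. Qed.

Lemma play_from_next (A : pointedType) (s1 : strategy1 A) (s2 : strategy2 A)
    (h : seq A) (t : nat) : (size h <= t)%N ->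
  play_from s1 s2 h t = next_action s1 s2 (mkseq (play_from s1 s2 h) t).
Proof.
set step := fun h' => rcons h' (next_action s1 s2 h').
move=> /subnKC <-; move: (t - size h)%N => {t} k.
suff H j : iter j step h = mkseq (play_from s1 s2 h) (size h + j).
  by rewrite {1}/play_from nth_default ?leq_addr// addKn -/step H.
elim: j => [|j IH] /=.
  rewrite addn0 -[LHS](mkseq_nth point).
  apply/eq_in_map => i; rewrite mem_iota add0n => /andP[_ ilt].
  by rewrite (play_from_history s1 s2 point ilt).
rewrite addnS mkseqS -IH; congr rcons.
by rewrite /play_from nth_default ?leq_addr// addKn.
Qed.

Definition payoff_from (R : realType) (A : pointedType) (u : play A -> R)
    (s1 : strategy1 A) (s2 : strategy2 A) (h : seq A) : R :=
  u (play_from s1 s2 h).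

Definition subgame_perfect_eps_equilibrium (R : realType) (A : pointedType)
    (u1 u2 : play A -> R) (eps : R) (s1 : strategy1 A) (s2 : strategy2 A) :
    Prop :=
  forall h : seq A,
    (forall t1 : strategy1 A,
       payoff_from u1 s1 s2 h >= payoff_from u1 t1 s2 h - eps) /\
    (forall t2 : strategy2 A,
       payoff_from u2 s1 s2 h >= payoff_from u2 s1 t2 h - eps).

Definition borel_payoff (R : realType) (A : pointedType) (u : play A -> R) :
    Prop :=
  measurable_fun [set: g_sigma_algebraType (@open (play A))] u.

(* Sequential, unlike the library's [lower_semicontinuous]; the inferior limit
   is taken in the extended reals, as [limn_inf] is only meaningful for bounded
   sequences. *)
Definition lower_semi_continuous (R : realType) (A : pointedType)
    (u : play A -> R) : Prop :=
  forall (p_ : nat -> play A) (p : play A), p_ k @[k --> \oo] --> p ->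
    ((u p)%:E <= limn_einf (fun k => (u (p_ k))%:E))%E.

(* Main.v *)
Require Import Defs.
From HB Require Import structures.
From mathcomp Require Import all_boot all_order all_algebra.
From mathcomp Require Import all_classical all_reals all_analysis.
From mathcomp Require wochoice.
Set Implicit Arguments.
Unset Strict Implicit.
Unset Printing Implicit Defensive.
Import Order.TTheory GRing.Theory Num.Theory.
Import numFieldNormedType.Exports.
Local Open Scope classical_set_scope.
Local Open Scope ring_scope.

(** Bounded payoffs may be rounded to a grid of mesh [eps], so that a play has
one of finitely many payoff classes.  Suppose that every history [h] carries a
nonempty set [P h] of plays extending it such that a play of [P h] remains in
[P] along itself, and such that the mover at [h], whatever action [a] he
chooses, can be answered by a play of [P (rcons h a)] whose class is no better
for him ([stable_plays]).  Then follow a play of [P], and after each deviation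
switch to such an answer ([stable_plan]).  A player who deviates, even
infinitely often, sees the class of the current plan never increase.  The
current plans converge to the play that he produces, so by lower semicontinuity
this play is worth at most one mesh more than the plan he left
([plan_deviation]).

The sets [P] come from transfinite elimination.  At a stage [w], a history
rejects a class [c] when its mover has an action after which all classes that
were still viable at some earlier stage are strictly better for him than [c];
a class is viable at [h] when it is the class of a play through [h] such that
no history along it, from [h] on, rejects it.  Rejections increase with the
stage, and along a well-order too long to embed in the set of all rejection
tables two of them coincide, which is the stability wanted
([stable_rejection]).

The heart of the matter is that no history ever loses all its classes
([viable_nonempty]).  The argument needs room, so it is carried out for games
on a part of the tree, in which leaving the part ends the game with a class
taken from a prescribed nonempty set.  Consider a least stage [w] at which some
game fails and, for it, a game with the fewest classes that are viable, at some
history inside, at all stages before [w].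
- Keep inside only the histories with no viable class at [w], and let the game
  end elsewhere with what is viable there ([unsolved]).  Only classes that were
  viable in the first game are viable in this one, and at [w] none is viable at
  an inner history.
- Pick a class [e] that is viable somewhere at all stages before [w], and keep
  inside only the histories at which it is not, the others ending the game with
  [e] ([avoiding]).  This game has lost the class [e], so by minimality it has
  viable classes at [w]; but these are viable in the previous game too, because
  a history that has lost [e] rejects it whenever one of its successors has kept
  it ([viable_avoiding]).  Hence no inner history has lost [e].
- So [e] is viable at all inner histories before [w], and no move that stays
  inside makes a history reject [e] or a class that its mover prefers to [e].
  If some history rejects [e], this is due to a move out of the game, and the
  best class that its mover can secure by moving out is viable there.  If none
  does, [e] itself is viable at [w] ([viable_of_before]).
Both outcomes contradict the choice of the inner histories. *)

(** * Games on a part of the tree, and viable classes *)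

Section Viable.
Context {A : pointedType} {V : finType}.
Variables (out : (nat -> A) -> V) (pay : seq A -> V -> nat).

(** Play goes on at the [inner] histories; on first reaching another history it
ends, with one of the classes in [exits].  Leaving the choice among several
classes open is what lets a set of solutions be summarised by its outcomes. *)
Record game := Game { inner : set (seq A); exits : seq A -> set V }.

Definition exits_nonempty (G : game) :=
  forall h, ~ inner G h -> exists c, exits G h c.

Inductive viable (G : game) (rejects : seq A -> V -> Prop) (c : V) :
    seq A -> Prop :=
| viable_exit h : ~ inner G h -> exits G h c -> viable G rejects c h
| viable_play h p : mkseq p (size h) = h -> out p = c ->
    (forall n, (size h <= n)%N ->
       inner G (mkseq p n) /\ ~ rejects (mkseq p n) c) ->
    viable G rejects c h
| viable_step h a : inner G h -> ~ rejects h c ->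
    viable G rejects c (rcons h a) -> viable G rejects c h.

Definition unrejected (h : seq A) (c : V) := False.

Lemma viable_outer G r c h : ~ inner G h -> viable G r c h -> exits G h c.
Proof.
move=> nK v; case: v nK => // {}h.
- by move=> p ph _ /(_ (size h) (leqnn _)) []; rewrite ph.
Qed.

Lemma viable_sub G r G' r' c h :
  (forall h, inner G' h -> inner G h) ->
  (forall h, inner G' h -> r h c -> r' h c) ->
  (forall h, ~ inner G' h -> exits G' h c -> viable G r c h) ->
  viable G' r' c h -> viable G r c h.
Proof.
move=> KK rr EE; elim=> {h} [h|h p ph pc ok|h a Kh nr _ IH].
- exact: EE.
- apply: (viable_play ph pc) => n /ok[Kn nr]; split; first exact: KK.
  by move/(rr _ Kn).
- by apply: viable_step IH; [exact: KK|move/(rr _ Kh)].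
Qed.

Lemma viable_unrejected G h : exits_nonempty G ->
  exists c, viable G unrejected c h.
Proof.
(* any play through h ends the game at its first non-inner history, if any *)
move=> Gne; pose p n := nth point h n.
have ph : mkseq p (size h) = h by rewrite /p mkseq_nth.
have [allK|] := pselect (forall n, (size h <= n)%N -> inner G (mkseq p n)).
  by exists (out p); apply: (viable_play ph) => // n /allK Kn; split.
move=> /existsNP[n0 /not_implyP[hn0 nK0]].
have exn : exists n, (size h <= n)%N && ~~ `[< inner G (mkseq p n) >].
  by exists n0; rewrite hn0; apply/asboolPn.
case: (ex_minnP exn) => n /andP[hn /asboolPn nK] nmin.
have [c Ec] := Gne _ nK; exists c.
suff H k : (size h + k <= n)%N -> viable G unrejected c (mkseq p (n - k)).
  by have := H (n - size h)%N; rewrite subnKC// subKn// ph; exact.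
elim: k => [_|k IH hk]; first by rewrite subn0; exact: viable_exit.
have kn : (k < n)%N by rewrite (leq_trans _ hk)// addnS ltnS leq_addl.
apply: (@viable_step _ _ _ _ (p (n - k.+1)%N)) => //.
  apply: contrapT => nK'; have := nmin (n - k.+1)%N.
  rewrite leq_subRL ?(leq_trans (leq_addl _ _) hk)// addnC hk/=.
  move/(_ (introT (asboolPn _) nK')).
  by rewrite leqNgt ltn_subrL (leq_ltn_trans _ kn).
rewrite -mkseqS -subSn// subSS; apply: IH.
by apply: leq_trans hk; rewrite addnS.
Qed.

(** * Transfinite elimination *)

Section Stages.
Variables (W : Type) (lt : W -> W -> Prop).
Hypothesis lt_wf : well_founded lt.
Hypothesis lt_trans : forall x y z, lt x y -> lt y z -> lt x z.
Hypothesis lt_total : forall x y, [\/ lt x y, x = y | lt y x].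

Definition rej_step G w (r : forall w', lt w' w -> seq A -> V -> Prop)
    (h : seq A) (c : V) :=
  exists w' (ltw : lt w' w) a, forall c',
    viable G (r w' ltw) c' (rcons h a) -> (pay h c < pay h c')%N.

Definition rej G : W -> seq A -> V -> Prop := Fix lt_wf _ (rej_step G).

Lemma rejP G w h c :
  rej G w h c <-> exists w', lt w' w /\ exists a, forall c',
    viable G (rej G w') c' (rcons h a) -> (pay h c < pay h c')%N.
Proof.
rewrite /rej Fix_eq; last first.
  move=> x f g fg; congr rej_step.
  by apply: functional_extensionality_dep => y;
    apply: functional_extensionality_dep => ?.
split=> [[w' [ltw [a H]]]|[w' [ltw [a H]]]].
  by exists w'; split => //; exists a.
by exists w', ltw, a.
Qed.

Lemma rej_mono G w w' h c : lt w w' -> rej G w h c -> rej G w' h c.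
Proof.
move=> ww' /rejP[x [xw H]]; apply/rejP; exists x; split => //.
exact: lt_trans xw ww'.
Qed.

Lemma viable_mono G w w' c h : lt w w' ->
  viable G (rej G w') c h -> viable G (rej G w) c h.
Proof.
move=> ww'; apply: viable_sub => // ? *; first exact: rej_mono ww' _.
exact: viable_exit.
Qed.

(** The first conjunct gives the set of these classes its meaning at the least
stage, which has no stage before it. *)
Definition before G w h c := viable G unrejected c h /\
  forall w', lt w' w -> viable G (rej G w') c h.

Lemma before_mono G w w' h c : lt w' w -> before G w h c -> before G w' h c.
Proof.
by move=> w'w [v0 v]; split => // x xw'; apply: v; exact: lt_trans xw' w'w.
Qed.

Lemma viable_before G w h c : viable G (rej G w) c h -> before G w h c.
Proof.
move=> v; split=> [|w' ww']; last exact: viable_mono v.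
by apply: viable_sub v => // *; exact: viable_exit.
Qed.

(** The sets of viable classes at [h] form a chain of nonempty subsets of a
finite type, so they have a common element. *)
Lemma before_nonempty G w h : exits_nonempty G ->
  (forall w', lt w' w -> exists c, viable G (rej G w') c h) ->
  exists c, before G w h c.
Proof.
move=> Gne H; apply: contrapT => /forallNP nb.
have bad c : viable G unrejected c h ->
    exists w', lt w' w /\ ~ viable G (rej G w') c h.
  move=> vc; apply: contrapT => nw; apply: (nb c); split => // w' ww'.
  by apply: contrapT => nv; apply: nw; exists w'.
have [c0 v0] := viable_unrejected h Gne; have [w0 [ww0 _]] := bad _ v0.
(* the latest of finitely many stages kills all classes at once *)
have [x [xw dead]] : exists x, lt x w /\
    forall c, c \in enum V -> ~ viable G (rej G x) c h.
  elim: (enum V) => [|c s [x [xw IH]]]; first by exists w0.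
  have [vc|nvc] := pselect (viable G unrejected c h); last first.
    exists x; split => // d; rewrite inE => /orP[/eqP->|/IH//].
    by case/viable_before.
  have [y [yw nv]] := bad _ vc.
  have [xy|xy|yx] := lt_total x y.
  - exists y; split => // d; rewrite inE => /orP[/eqP->//|/IH nd vd].
    by apply: nd; exact: viable_mono xy vd.
  - exists y; split => // d; rewrite inE => /orP[/eqP->//|/IH].
    by rewrite xy.
  - exists x; split => // d; rewrite inE => /orP[/eqP->|/IH//] vd.
    by apply: nv; exact: viable_mono yx vd.
have [c vc] := H _ xw; apply: (dead c) => //; exact: mem_enum.
Qed.

(** * Shrinking a game *)

Definition refines G' G w := (forall h, inner G' h -> inner G h) /\
  forall h c, ~ inner G' h -> exits G' h c -> before G w h c.

Lemma refines_mono G G' w w' : lt w' w -> refines G' G w -> refines G' G w'.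
Proof.
move=> w'w [KK EE]; split=> // h c nK Ec.
by apply: before_mono w'w _; exact: EE.
Qed.

(** Fewer classes are viable in a game that refines another one, so an action
secures more there and more classes are rejected, which in turn leaves fewer
viable ones. *)
Lemma rej_refines G G' w h c : refines G' G w -> rej G w h c -> rej G' w h c.
Proof.
elim/(well_founded_ind lt_wf): w h c => w IH h c ref /rejP[x [xw [a H]]].
apply/rejP; exists x; split => //; exists a => c' v; apply: H.
apply: viable_sub v => [|g _|g nK Ec]; first by case: ref.
  by apply: (IH _ xw); exact: refines_mono ref.
by have [_ /(_ _ _ nK Ec)[_]] := ref; exact.
Qed.

Lemma before_refines G G' w h c :
  refines G' G w -> before G' w h c -> before G w h c.
Proof.
move=> ref [v0 v]; have [KK EE] := ref; split.
  by apply: viable_sub v0 => // g nK Ec; case: (EE _ _ nK Ec).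
move=> w' ww'; apply: viable_sub (v _ ww') => // [g _|g nK Ec].
  by apply: rej_refines; exact: refines_mono ref.
by case: (EE _ _ nK Ec) => _; exact.
Qed.

Definition alive G w : {set V} :=
  [set c | `[< exists h, inner G h /\ before G w h c >]]%SET.

Lemma alive_refines G G' w : refines G' G w -> alive G' w \subset alive G w.
Proof.
move=> ref; apply/fintype.subsetP => c; rewrite !inE => -[x [Kx bx]].
by exists x; split; [case: ref => KK _; exact: KK|exact: before_refines bx].
Qed.

Definition unsolved G w := Game
  (fun x => inner G x /\ forall c, ~ viable G (rej G w) c x)
  (fun x c => viable G (rej G w) c x).

Lemma unsolved_exits_nonempty G w :
  exits_nonempty G -> exits_nonempty (unsolved G w).
Proof.
move=> Gne x nbx /=; apply: contrapT => /forallNP nv.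
have [Kx|nKx] := pselect (inner G x); first by apply: nbx.
by have [c /(viable_exit (rej G w) nKx)] := Gne _ nKx; exact: nv.
Qed.

Lemma unsolved_refines G w : refines (unsolved G w) G w.
Proof. by split=> [x []//|x c _ /viable_before]. Qed.

Lemma unsolved_not_viable G w x c : inner (unsolved G w) x ->
  ~ viable (unsolved G w) (rej (unsolved G w) w) c x.
Proof.
move=> [_ nv] v; apply: (nv c); apply: viable_sub v => [y []//|y _|//].
exact: rej_refines (unsolved_refines G w).
Qed.

Definition avoiding G w e := Game
  (fun x => inner G x /\ ~ before G w x e)
  (fun x c => (inner G x /\ c = e) \/ (~ inner G x /\ exits G x c)).

Lemma avoiding_exits_nonempty G w e :
  exits_nonempty G -> exits_nonempty (avoiding G w e).
Proof.
move=> Gne x ngx /=; have [bx|nbx] := pselect (inner G x).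
  by exists e; left.
by have [c Ec] := Gne _ nbx; exists c; right.
Qed.

Lemma before_not_avoiding G w e x :
  inner G x -> ~ inner (avoiding G w e) x -> before G w x e.
Proof. by move=> Kx ngx; apply: contrapT => nb; apply: ngx. Qed.

Lemma avoiding_refines G w e : refines (avoiding G w e) G w.
Proof.
split=> [x []//|x c ngx [[Kx ->]|[nKx Ec]]].
  exact: before_not_avoiding.
by apply: viable_before; exact: viable_exit.
Qed.

Lemma avoiding_not_alive G w e : e \notin alive (avoiding G w e) w.
Proof.
rewrite inE; apply/asboolPn => -[x [[_ nb] bx]]; apply: nb.
exact: before_refines (avoiding_refines G w e) bx.
Qed.

(** The exits with class [e] that [avoiding] creates are never taken: if a
history accepts [e] at stage [w] and has a successor where [e] is viable at all
earlier stages, then [e] is viable there at all earlier stages too. *)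
Lemma viable_avoiding G w e x c : inner (avoiding G w e) x ->
  viable (avoiding G w e) (rej (avoiding G w e) w) c x ->
  viable G (rej G w) c x.
Proof.
have nrej y d : ~ rej (avoiding G w e) w y d -> ~ rej G w y d.
  by move=> nr /(rej_refines (avoiding_refines G w e)).
move=> gx v; elim: v gx => {x} [x ngx _ gx|x p px pc ok _|x a gx nr v IH _].
- by case: ngx.
- by apply: (viable_play px pc) => m /ok[[Km _] /nrej].
- have [Kx nbx] := gx.
  have [gxa|ngxa] := pselect (inner (avoiding G w e) (rcons x a)).
    by apply: viable_step (IH gxa) => //; exact: nrej.
  case: (@viable_outer (avoiding G w e) _ _ _ ngxa v) => [[Kxa ce]|[nKxa Ec]].
    have [v0 vw] := before_not_avoiding Kxa ngxa.
    case: nbx; subst c; split; first exact: viable_step v0.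
    move=> w' ww'; apply: viable_step (vw _ ww') => //.
    by move=> /(rej_mono ww')/(nrej _ _ nr).
  by apply: (@viable_step _ _ _ _ a) => //; [exact: nrej|exact: viable_exit].
Qed.

(** If [x] rejects [e], or a class that its mover likes at least as much, then
it is because of an action that ends the game: after an inner one, [e] would be
viable.  So the best class above [e] that the mover can secure by ending the
game is not rejected. *)
Lemma viable_of_before G w e h : exits_nonempty G ->
  (forall x, inner G x -> before G w x e) -> inner G h ->
  exists x c, inner G x /\ viable G (rej G w) c x.
Proof.
move=> Gne before_e Kh.
have [[x [Kx rejx]]|nrej] := pselect (exists x, inner G x /\ rej G w x e);
    last first.
  exists h, e; split => //; have [v0 _] := before_e _ Kh.
  apply: viable_sub v0 => [//|y Ky re|y]; last exact: viable_exit.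
  by apply: nrej; exists y.
pose better c := exists b, [/\ ~ inner G (rcons x b), exits G (rcons x b) c &
  (pay x e < pay x c)%N].
have to_better d : (pay x e <= pay x d)%N -> rej G w x d ->
    exists c, better c /\ (pay x d < pay x c)%N.
  move=> ed /rejP[w' [ww' [b Hb]]].
  have nKb : ~ inner G (rcons x b).
    by move=> /before_e[_ /(_ _ ww')/Hb]; rewrite ltnNge ed.
  have [c Ec] := Gne _ nKb.
  have dc : (pay x d < pay x c)%N by apply: Hb; exact: viable_exit.
  by exists c; split => //; exists b; split => //; exact: leq_ltn_trans dc.
have [c0 [bc0 _]] := to_better _ (leqnn _) rejx.
pose c := [arg max_(c > c0 | `[< better c >]) pay x c].
have [bc cmax] : better c /\ forall d, better d -> (pay x d <= pay x c)%N.
  rewrite /c; case: arg_maxnP => [|d /asboolP bd dmax]; first exact/asboolP.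
  by split => // d' bd'; apply: dmax; apply/asboolP.
have [b [nKb Ec ec]] := bc; exists x, c; split => //.
apply: (@viable_step _ _ _ _ b) => //; last exact: viable_exit.
move=> /(to_better _ (ltnW ec))[d [bd cd]].
by move: (cmax _ bd); rewrite leqNgt cd.
Qed.

(** Induction on the stage, then on the number of classes that are viable
somewhere before it. *)
Lemma viable_nonempty w G h : exits_nonempty G ->
  exists c, viable G (rej G w) c h.
Proof.
elim/(well_founded_ind lt_wf): w G h => w IHw G h Gne.
have [n leGn] := ubnP #|alive G w|; elim: n => // n IHn in G h Gne leGn *.
apply: contrapT => bad_h; pose G1 := unsolved G w.
have G1ne : exits_nonempty G1 by exact: unsolved_exits_nonempty.
have K1h : inner G1 h.
  split; last by move=> c v; apply: bad_h; exists c.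
  apply: contrapT => nKh; have [c Ec] := Gne _ nKh.
  by apply: bad_h; exists c; exact: viable_exit.
have [e e_h] : exists e, before G1 w h e.
  by apply: before_nonempty => // w' ww'; exact: IHw.
pose G2 := avoiding G1 w e.
have G2n : (#|alive G2 w| < n)%N.
  rewrite -ltnS; apply: leq_trans leGn; rewrite ltnS; apply: proper_card.
  apply: (@proper_sub_trans _ _ (mem (alive G1 w))); last first.
    exact: alive_refines (unsolved_refines G w).
  apply/properP; split; first exact: alive_refines (avoiding_refines G1 w e).
  by exists e; [rewrite inE; apply/asboolP; exists h|exact: avoiding_not_alive].
have before_e x : inner G1 x -> before G1 w x e.
  move=> K1x; apply: before_not_avoiding => // K2x.
  have [c v] := IHn G2 x (avoiding_exits_nonempty G1ne) G2n.
  exact: (unsolved_not_viable K1x) (viable_avoiding K2x v).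
have [x [c [K1x v]]] := viable_of_before G1ne before_e K1h.
exact: unsolved_not_viable K1x v.
Qed.

End Stages.
End Viable.

(** * Stable rejections and stable plans *)

Lemma well_ordering (T : choiceType) : exists lt : T -> T -> Prop,
  [/\ well_founded lt, (forall x y z, lt x y -> lt y z -> lt x z) &
    forall x y, [\/ lt x y, x = y | lt y x]].
Proof.
have [r wo] := wochoice.well_ordering_principle T.
have woT : wochoice.wo_chain r predT by move=> C _; exact: wo.
have tot x y : r x y || r y x by apply: (wochoice.wo_chainW woT).
have anti x y : r x y -> r y x -> x = y.
  move=> xy yx; apply: (wochoice.wo_chain_antisymmetric woT) => //.
  by rewrite xy yx.
have least (C : {pred T}) : wochoice.nonempty C ->
    exists z, z \in C /\ forall x, x \in C -> r z x.
  by move=> /wo[z [[zC zmin] _]]; exists z.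
exists (fun x y => r x y /\ x <> y); split.
- move=> x; apply: contrapT => nax.
  have [|z [/asboolP naz zmin]] :=
      least (fun x => `[< ~ Acc (fun x y => r x y /\ x <> y) x >]).
    by exists x; apply/asboolP.
  apply: naz; constructor => y [yz ney]; apply: contrapT => nay.
  by apply: ney; apply: anti => //; apply: zmin; apply/asboolP.
- move=> x y z [xy nxy] [yz nyz]; split; last first.
    by move=> xz; subst z; apply: nxy; exact: anti.
  have [|w [wC wmin]] := least (pred3 x y z).
    by exists x; rewrite !inE eqxx.
  have wx : r w x by apply: wmin; rewrite !inE eqxx.
  have wy : r w y by apply: wmin; rewrite !inE eqxx orbT.
  have wz : r w z by apply: wmin; rewrite !inE eqxx !orbT.
  move: wC; rewrite !inE => /or3P[/eqP<-//|/eqP wE|/eqP wE]; subst w.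
    by case: nxy; exact: anti.
  by case: nyz; exact: anti.
- move=> x y; have [->|/eqP ne] := eqVneq x y; first exact: Or32.
  have /orP[xy|yx] := tot x y; first exact: Or31.
  by apply: Or33; split => // yxE; apply: ne.
Qed.

Lemma cantor_injective (S : Type) (f : set S -> S) : ~ injective f.
Proof.
move=> inj; pose D x := exists B, f B = x /\ ~ B x.
have [Df|nDf] := pselect (D (f D)); last by apply: (nDf); exists D; split.
by have [B [/inj BD nB]] := Df; apply: nB; rewrite BD.
Qed.

Section Stable.
Context {A : pointedType} {V : finType}.
Variables (out : (nat -> A) -> V) (pay : seq A -> V -> nat).

Definition full_game : game := @Game A V setT (fun _ => set0).

(** The stages are the sets of tables of rejected pairs, well-ordered.  The table
cannot strictly increase along all of them, as this would inject the sets of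
tables into the tables. *)
Lemma stable_rejection : exists r : seq A -> V -> Prop,
  (forall h, exists c, viable out full_game r c h) /\
  (forall h c a, (forall c', viable out full_game r c' (rcons h a) ->
     (pay h c < pay h c')%N) -> r h c).
Proof.
have [lt [wf tr tot]] := well_ordering (set (set (seq A * V))).
pose r w := rej out pay wf full_game w.
have [w [w' [ww' st]]] :
    exists w w', lt w w' /\ forall h c, r w' h c -> r w h c.
  apply: contrapT => nst.
  have strict w w' : lt w w' -> [set x | r w x.1 x.2] <> [set x | r w' x.1 x.2].
    move=> ww' eqr; apply: nst; exists w, w'; split=> // h c rc.
    by have : [set x | r w' x.1 x.2] (h, c) by []; rewrite -eqr.
  apply: (@cantor_injective _ (fun w => [set x | r w x.1 x.2])) => w w' eqr.
  by have [/strict|//|/strict/nesym] := tot w w'.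
exists (r w); split=> [h|h c a H].
  by apply: viable_nonempty => // g ng; case: ng.
by apply: st; apply/rejP; exists w; split => //; exists a.
Qed.

(** A play of [P h] is not rejected at [h]: whatever action the mover takes, some
class that is viable after it is no better for him. *)
Lemma stable_plays : exists P : seq A -> set (nat -> A),
  [/\ forall h, P h !=set0,
      forall h p, P h p -> mkseq p (size h) = h,
      forall h p, P h p -> P (rcons h (p (size h))) p &
      forall h p a, P h p -> exists2 q, P (rcons h a) q &
        (pay h (out q) <= pay h (out p))%N].
Proof.
have [r [rne rst]] := stable_rejection.
pose P h : set (nat -> A) := [set p | mkseq p (size h) = h /\
  forall n, (size h <= n)%N -> ~ r (mkseq p n) (out p)].
have viableP h c : viable out full_game r c h <-> exists2 p, P h p & out p = c.
  split=> [|[p [ph pr] pc]]; last first.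
    by apply: (viable_play ph pc) => n /pr; rewrite pc.
  elim=> {h} [h []//|h p ph pc ok|h a _ nr _ [p [ph pr] pc]].
    by exists p => //; split => // n /ok[_]; rewrite pc.
  move: ph; rewrite size_rcons mkseqS => /rcons_inj[ph pa].
  exists p => //; split => // n; rewrite leq_eqVlt => /orP[/eqP<-|hn].
    by rewrite ph pc.
  by apply: pr; rewrite size_rcons.
exists P; split.
- by move=> h; have [c /viableP[p Pp _]] := rne h; exists p.
- by move=> h p [].
- move=> h p [ph pr]; split; first by rewrite size_rcons mkseqS ph.
  by move=> n hn; apply: pr; rewrite (leq_trans _ hn)// size_rcons.
- move=> h p a [ph pr]; apply: contrapT => nq.
  apply: (pr (size h)) => //; rewrite ph; apply: (rst _ _ a).
  move=> c' /viableP[q Pq <-].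
  by rewrite ltnNge; apply/negP => qp; apply: nq; exists q.
Qed.

(** [plan h] is the play that the players intend to follow at [h]: it is kept as
long as they do, and replaced by a punishment of the last mover when it is not
followed. *)
Lemma stable_plan : exists plan : seq A -> (nat -> A),
  [/\ forall h, mkseq (plan h) (size h) = h,
      forall h, plan (rcons h (plan h (size h))) = plan h &
      forall h a, (pay h (out (plan (rcons h a))) <= pay h (out (plan h)))%N].
Proof.
have [P [Pne Ph Pn Pp]] := stable_plays.
have [punish punishP] : {f & forall x : seq A * (nat -> A) * A,
    P x.1.1 x.1.2 -> P (rcons x.1.1 x.2) (f x) /\
      (pay x.1.1 (out (f x)) <= pay x.1.1 (out x.1.2))%N}.
  apply: (@choice _ _ (fun x q => P x.1.1 x.1.2 -> P (rcons x.1.1 x.2) q /\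
      (pay x.1.1 (out q) <= pay x.1.1 (out x.1.2))%N)) => -[[h p] a] /=.
  have [/(Pp _ _ a)[q Pq qp]|nP] := pselect (P h p); first by exists q.
  by exists p.
have [p0 Pp0] := Pne [::].
(* histories grow at their end, so the recursion runs on the reversed history *)
pose fix plan_rev (s : seq A) : nat -> A :=
  if s is a :: s' then
    if plan_rev s' (size s') == a then plan_rev s'
    else punish (rev s', plan_rev s', a)
  else p0.
pose plan h := plan_rev (rev h).
have planS h a : plan (rcons h a) =
    if plan h (size h) == a then plan h else punish (h, plan h, a).
  by rewrite /plan rev_rcons /= size_rev revK.
have planP h : P h (plan h).
  elim/last_ind: h => [//|h a IH]; rewrite planS.
  case: eqP => [<-|_]; first exact: Pn.
  by have [] := punishP (h, plan h, a) IH.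
exists plan; split=> [h|h|h a].
- exact: Ph.
- by rewrite planS eqxx.
- rewrite planS; case: eqP => // _.
  by have [] := punishP (h, plan h, a) (planP h).
Qed.

End Stable.

(** * Convergence of plays and rounding of payoffs *)

Lemma cvg_play (A : pointedType) (p_ : nat -> play A) (p : play A) :
  (forall t, \forall k \near \oo, p_ k t = p t) -> p_ k @[k --> \oo] --> p.
Proof.
move=> H; apply/cvg_sup => t B; rewrite (nbhsE (T := initial_topology _)).
move=> -[C [[D oD <-] Dp] CB].
suff : \forall k \near \oo, B (p_ k) by [].
by apply: filterS (H t) => k pk; apply: CB; rewrite /preimage/= pk.
Qed.

Lemma lsc_le (R : realType) (A : pointedType) (u : play A -> R)
    (p_ : nat -> play A) (p : play A) (b : R) :
  lower_semi_continuous u -> p_ k @[k --> \oo] --> p ->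
  (forall k, u (p_ k) <= b) -> u p <= b.
Proof.
move=> ulsc /ulsc uliminf ub; rewrite -lee_fin (le_trans uliminf)//.
rewrite limn_einf_lim; apply: lime_le; first exact: is_cvg_einfs.
apply: nearW => n; apply: (@le_trans _ _ (u (p_ n))%:E); last by rewrite lee_fin.
by apply: ereal_inf_lbound; exists n => /=.
Qed.

(** [g x] numbers the cell of [u x] in a grid of mesh [eps]. *)
Lemma bounded_classes (R : realType) (T : Type) (u : T -> R) (eps : R) :
  bounded_fun u -> 0 < eps -> exists N (g : T -> 'I_N.+1),
    forall x y, (g x <= g y)%N -> u x <= u y + eps.
Proof.
move=> [M0 [_ /(_ (M0 + 1))]]; rewrite ltrDl ltr01 => /(_ isT) ubM eps0.
set M := M0 + 1 in ubM; have uM x : `|u x| <= M by exact: ubM.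
pose v x := (u x + M) / eps.
have v0 x : 0 <= v x.
  apply: divr_ge0 => [|]; last exact: ltW.
  rewrite -[M]opprK subr_ge0.
  by have := uM x; rewrite ler_norml => /andP[].
have vN x : v x <= (M + M) / eps.
  rewrite ler_pM2r ?invr_gt0// lerD2r.
  by have := uM x; rewrite ler_norml => /andP[].
pose N := Num.truncn ((M + M) / eps).
have gN x : (Num.truncn (v x) < N.+1)%N by rewrite ltnS; exact: le_truncn.
exists N, (fun x => Ordinal (gN x)) => x y /= xy.
have /andP[_ vx] := truncn_itv (v0 x); have /andP[vy _] := truncn_itv (v0 y).
have : v x <= v y + 1.
  apply: (le_trans (ltW vx)); rewrite -natr1 lerD2r (le_trans _ vy)//.
  by rewrite ler_nat.
rewrite -{1}(divff (lt0r_neq0 eps0)) -mulrDl ler_pM2r ?invr_gt0//.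
by rewrite addrAC lerD2r.
Qed.

(** * Deviations from a plan *)

Section Deviation.
Context {R : realType} {A : pointedType}.
Variables (plan : seq A -> play A) (h : seq A) (q : play A).
Hypothesis plan_extends : forall h, mkseq (plan h) (size h) = h.
Hypothesis plan_follow :
  forall h, plan (rcons h (plan h (size h))) = plan h.
Hypothesis qh : mkseq q (size h) = h.

Lemma plan_step n : q n = plan (mkseq q n) n ->
  plan (mkseq q n.+1) = plan (mkseq q n).
Proof.
by move=> qn; have := plan_follow (mkseq q n); rewrite size_mkseq -qn -mkseqS.
Qed.

Lemma plan_followed : (forall n, (size h <= n)%N -> q n = plan (mkseq q n) n) ->
  q = plan h.
Proof.
move=> qn; have same k : plan (mkseq q (size h + k)) = plan h.
  elim: k => [|k IH]; first by rewrite addn0 qh.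
  by rewrite addnS plan_step ?IH// -IH qn ?leq_addr.
apply: funext => n; have [hn|nh] := leqP (size h) n.
  by rewrite qn// -(subnKC hn) same.
have eqn p : mkseq p (size h) = h -> p n = nth point h n :> A.
  by move=> <-; rewrite nth_mkseq.
by rewrite !eqn.
Qed.

(** Only player [i] deviates along [q], so the class [g] of the current plan does
not increase.  The plan at the history of length [n] of [q] agrees with [q] up
to [n], so the current plans converge to [q]. *)
Lemma plan_deviation (u : play A -> R) (eps : R) (g : play A -> nat) (i : bool) :
  lower_semi_continuous u ->
  (forall p p', (g p <= g p')%N -> u p <= u p' + eps) ->
  (forall h a, odd (size h) = i -> (g (plan (rcons h a)) <= g (plan h))%N) ->
  (forall n, (size h <= n)%N -> odd n != i -> q n = plan (mkseq q n) n) ->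
  u q <= u (plan h) + eps.
Proof.
move=> ulsc gu gle qn.
have dec k : (g (plan (mkseq q (size h + k))) <= g (plan h))%N.
  elim: k => [|k IH]; first by rewrite addn0 qh.
  apply: leq_trans IH; rewrite addnS.
  have [odd_i|odd_ni] := eqVneq (odd (size h + k)) i.
    by rewrite mkseqS; apply: gle; rewrite size_mkseq.
  by rewrite plan_step// qn ?leq_addr.
apply: (@lsc_le _ _ u (fun k => plan (mkseq q (size h + k)))) => //; last first.
  by move=> k; apply: gu; exact: dec.
apply: cvg_play => t; near=> k.
have tk : (t < size h + k)%N.
  by rewrite (leq_trans _ (leq_addl _ _))//; near: k; exact: nbhs_infty_gt.
have := plan_extends (mkseq q (size h + k)); rewrite size_mkseq.
by move=> /(congr1 (fun s => nth point s t)); rewrite !nth_mkseq.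
Unshelve. all: by end_near. Qed.

End Deviation.

Lemma play_from_extends (A : pointedType)
    (s1 : strategy1 A) (s2 : strategy2 A) h :
  mkseq (play_from s1 s2 h) (size h) = h.
Proof.
rewrite -[RHS](mkseq_nth point); apply/eq_in_map => t.
rewrite mem_iota => /andP[_ th].
exact: play_from_history.
Qed.

Lemma next_action_split (A : pointedType)
    (s1 : strategy1 A) (s2 : strategy2 A) h :
  (exists p, next_action s1 s2 h = s1 (exist _ h p)) \/
  (exists p, next_action s1 s2 h = s2 (exist _ h p)).
Proof.
rewrite /next_action; move: (boolP _) => s.
by refine (match s with AltTrue p => _ | AltFalse p => _ end);
  [right|left]; exists p.
Qed.

Lemma next_action_odd (A : pointedType)
    (s1 t1 : strategy1 A) (s2 : strategy2 A) h :
  odd (size h) -> next_action t1 s2 h = next_action s1 s2 h.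
Proof.
rewrite /next_action; move: (boolP _) => s.
by refine (match s with AltTrue p => _ | AltFalse p => _ end) => //;
  rewrite (negPf p).
Qed.

Lemma next_action_even (A : pointedType)
    (s1 : strategy1 A) (s2 t2 : strategy2 A) h :
  ~~ odd (size h) -> next_action s1 t2 h = next_action s1 s2 h.
Proof.
rewrite /next_action; move: (boolP _) => s.
by refine (match s with AltTrue p => _ | AltFalse p => _ end) => //;
  rewrite p.
Qed.

Theorem theorem9 (R : realType) (A : pointedType) (u1 u2 : play A -> R)
    (u1_borel : borel_payoff u1) (u2_borel : borel_payoff u2)
    (u1_lsc : lower_semi_continuous u1) (u2_lsc : lower_semi_continuous u2)
    (u1_bounded : bounded_fun u1) (u2_bounded : bounded_fun u2)
    (eps : R) (eps_gt0 : 0 < eps) :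
  exists (s1 : strategy1 A) (s2 : strategy2 A),
    subgame_perfect_eps_equilibrium u1 u2 eps s1 s2.
Proof.
have [N1 [g1 g1P]] := bounded_classes u1_bounded eps_gt0.
have [N2 [g2 g2P]] := bounded_classes u2_bounded eps_gt0.
pose out (p : play A) := (g1 p, g2 p).
(* the cell of the mover's payoff *)
pose pay (h : seq A) (c : 'I_N1.+1 * 'I_N2.+1) : nat :=
  if odd (size h) then val c.2 else val c.1.
have [plan [plan_ext plan_follow plan_pun]] := stable_plan out pay.
pose s1 : strategy1 A := fun h => plan (sval h) (size (sval h)).
pose s2 : strategy2 A := fun h => plan (sval h) (size (sval h)).
have nextE h : next_action s1 s2 h = plan h (size h).
  by have [[p ->]|[p ->]] := next_action_split s1 s2 h.
exists s1, s2 => h.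
have planE : play_from s1 s2 h = plan h.
  apply: plan_followed => //.
    exact: play_from_extends.
  by move=> n hn; rewrite {1}play_from_next// nextE size_mkseq.
split=> [t1|t2]; rewrite lerBlDr /payoff_from planE.
  apply: (@plan_deviation _ _ plan _ _ plan_ext plan_follow _ _ _ g1 false) => //.
  - exact: play_from_extends.
  - by move=> g a og; have := plan_pun g a; rewrite /pay og.
  - move=> n hn odd_n; rewrite {1}play_from_next//.
    rewrite (next_action_odd s1) ?nextE ?size_mkseq//.
    by case: (odd n) odd_n.
apply: (@plan_deviation _ _ plan _ _ plan_ext plan_follow _ _ _ g2 true) => //.
- exact: play_from_extends.
- by move=> g a og; have := plan_pun g a; rewrite /pay og.
- move=> n hn odd_n; rewrite {1}play_from_next//.
  rewrite (next_action_even _ s2) ?nextE ?size_mkseq//.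
  by case: (odd n) odd_n.
Qed.
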